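(* For every $n\ge 3$, player $\mathcal{B}$ has a symmetric strategy in the avoidance game $(K_n,P_2)$; that is, $\mathcal{B}$ has a strategy such that, independently of $\mathcal{A}$'s strategy, after every move of $\mathcal{B}$ made during the game $(K_n,P_2)$ (i.e., as long as the game has not ended), the red subgraph and the blue subgraph are isomorphic.
   Context: All graphs are finite simple graphs; $K_n$ is the complete graph on $n$ vertices and $P_2$ is the path with 2 edges. Given a graph $G$, two players $\mathcal{A}$ and $\mathcal{B}$ alternately color edges of $G$, $\mathcal{A}$ in red and $\mathcal{B}$ in blue, with $\mathcal{A}$ moving first; in each move a player colors one so-far uncolored edge. A strategy for a player is a function assigning to each sequence of the opponent's previous moves an uncolored edge to color next. For a graph $F$ that is a subgraph of $G$, the avoidance game $(G,F)$ is played this way with the ending condition that the player who first creates a monochromatic subgraph of $G$ isomorphic to $F$ loses (and the game ends). The red (resp. blue) subgraph is the subgraph formed by the red (resp. blue) edges. *)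

(* Defs.v *)
From mathcomp Require Import all_boot.

Set Implicit Arguments.
Unset Strict Implicit.
Unset Printing Implicit Defensive.

Record sgraph := SGraph {
  vertex :> finType;
  edges : {set {set vertex}};
  edges_card2 : forall e, e \in edges -> #|e| = 2
}.

Definition graph_iso (G H : sgraph) : Prop :=
  exists2 f : G -> H, bijective f &
    forall e : {set G}, (f @: e \in edges H) = (e \in edges G).

Lemma complete_card2 n (e : {set 'I_n}) : e \in [set e : {set 'I_n} | #|e| == 2] -> #|e| = 2.
Proof. by rewrite inE => /eqP. Qed.

Definition complete_graph (n : nat) : sgraph := SGraph (@complete_card2 n).

Lemma path_card2 k (e : {set 'I_k.+1}) :
  e \in [set [set inord i; inord i.+1] | i : 'I_k] -> #|e| = 2.
Proof.
case/imsetP=> i _ ->; rewrite cards2.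
suff -> : (inord i : 'I_k.+1) != inord i.+1 by [].
by rewrite -val_eqE /= !inordK ?ltnS // ?(ltnW (ltn_ord i)) // neq_ltn ltnSn.
Qed.

(* The index counts edges, not vertices. *)
Definition path_graph (k : nat) : sgraph := SGraph (@path_card2 k).

Lemma subgraph_card2 (G : sgraph) (W : {set G}) (S : {set {set G}})
    (e : {set {x | x \in W}}) :
  e \in [set e : {set {x | x \in W}} | val @: e \in S :&: edges G] -> #|e| = 2.
Proof.
by rewrite !inE => /andP[_ /edges_card2]; rewrite card_imset //; apply: val_inj.
Qed.

(* Elements of S that are not edges of G, or not included in W, are discarded. *)
Definition subgraph (G : sgraph) (W : {set G}) (S : {set {set G}}) : sgraph :=
  SGraph (@subgraph_card2 G W S).

(* No isolated vertices: the vertices are the endpoints of the edges in S. *)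
Definition formed_by (G : sgraph) (S : {set {set G}}) : sgraph :=
  subgraph (cover S) S.

Definition contains_copy (G : sgraph) (S : {set {set G}}) (F : sgraph) : Prop :=
  exists W : {set G}, exists2 T : {set {set G}},
    T \subset S & graph_iso (subgraph W T) F.

Definition player := bool.
Definition playerA : player := false.
Definition playerB : player := true.

Section AvoidanceGame.
Variables G F : sgraph.

(* All moves of both players in chronological order: the moves of the first
   player A are those at even positions (counting from 0). *)
Definition history := seq {set G}.

Definition turn (h : history) : player := odd (size h).

Definition moves_of (p : player) (h : history) : seq {set G} :=
  mask (mkseq (fun i => odd i == p) (size h)) h.

Definition red_edges (h : history) : {set {set G}} :=
  [set e in moves_of playerA h].

Definition blue_edges (h : history) : {set {set G}} :=
  [set e in moves_of playerB h].

Definition uncolored (h : history) (e : {set G}) : bool :=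
  (e \in edges G) && (e \notin h).

Definition ended (h : history) : Prop :=
  [\/ contains_copy (red_edges h) F, contains_copy (blue_edges h) F
    | forall e, ~~ uncolored h e].

(* The game has not ended before the last move of h; it may end with it. *)
Inductive legal : history -> Prop :=
| legal_nil : legal [::]
| legal_rcons h e :
    legal h -> ~ ended h -> uncolored h e -> legal (rcons h e).

Definition follows (p : player) (s : seq {set G} -> {set G}) (h : history) :=
  forall i, i < size h -> odd i = p ->
    nth set0 h i = s (moves_of (~~ p) (take i h)).

(* "Uncolored" depends on the player's own earlier moves, which are determined
   by the strategy itself; s is unconstrained on the sequences of opponent's
   moves after which the player does not have to move. *)
Definition strategy (p : player) (s : seq {set G} -> {set G}) : Prop :=
  forall h, legal h -> follows p s h -> turn h = p -> ~ ended h ->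
    uncolored h (s (moves_of (~~ p) h)).

(* Every move of B counts, including one that ends the game. *)
Definition symmetric_strategy (sB : seq {set G} -> {set G}) : Prop :=
  strategy playerB sB /\
  forall sA, strategy playerA sA ->
  forall h, legal h -> follows playerA sA h -> follows playerB sB h ->
    0 < size h -> turn h = playerA ->
    graph_iso (formed_by (red_edges h)) (formed_by (blue_edges h)).

End AvoidanceGame.

(* Main.v *)
Require Import Defs.
From mathcomp Require Import all_boot zify.

(** A color class without P_2 is a matching, and two matchings of equal size
    span isomorphic graphs, so B only has to keep a matching of his own after
    each of his moves. With k blue edges and k+1 red ones, the n-2k vertices
    missed by blue carry at most a matching of red edges; so B can be stuck only
    when n-2k = 2 and the pair missed by blue is red. He prevents this one move
    earlier, when he misses 4 vertices: A misses just one pair, the only one A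
    can still play, and the red matching together with this pair is a matching,
    so it avoids some perfect matching of B's 4 missed vertices; B plays one of
    its two edges and keeps the other for his last move. *)

Set Implicit Arguments.
Unset Strict Implicit.
Unset Printing Implicit Defensive.

(** * Matchings and their extensions by one edge *)

Section Matchings.
Variable T : finType.
Implicit Types (R B S : {set {set T}}) (e r b F : {set T}).

Definition matching S := [forall e in S, #|e| == 2] && trivIset S.

Definition extends R B b := [&& b \notin R, b \notin B & matching (b |: B)].

(** The position with A to move. Only moves [r] keeping red a matching count, since any other red
    move ends the game; in [extends B R r] the two colors exchange roles. *)
Definition safe R B :=
  [forall r, extends B R r ==> [exists b, extends (r |: R) B b]].

Lemma matchingP S :
  reflect ((forall e, e \in S -> #|e| = 2) /\
           {in S &, forall e1 e2, e1 != e2 -> [disjoint e1 & e2]}) (matching S).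
Proof.
apply: (iffP andP) => [[/forall_inP c /trivIsetP t]|[c t]].
  by split=> // e /c /eqP.
by split; [apply/forall_inP=> e /c -> | apply/trivIsetP].
Qed.

Lemma matching_sub S1 S2 : S1 \subset S2 -> matching S2 -> matching S1.
Proof.
move=> /subsetP s /matchingP[c d]; apply/matchingP; split=> [e /s /c //|].
by move=> e1 e2 /s h1 /s h2; apply: d.
Qed.

Lemma matching0 : matching set0.
Proof. by apply/matchingP; split=> [e|e ?]; rewrite inE. Qed.

Lemma card_cover_matching S : matching S -> #|cover S| = #|S| * 2.
Proof.
case/andP=> /forall_inP c /eqP <-; rewrite -sum_nat_const.
by apply: eq_bigr => e /c /eqP.
Qed.

Lemma matching_add b B :
  matching B -> #|b| = 2 -> [disjoint b & cover B] -> matching (b |: B).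
Proof.
move=> /matchingP[c d] cb db; have dj e : e \in B -> [disjoint b & e].
  by move=> eB; apply: disjointWr db; apply: bigcup_sup.
apply/matchingP; split=> [e /setU1P[-> //|/c //]|].
move=> e1 e2 /setU1P[->|h1] /setU1P[->|h2]; rewrite ?eqxx //; last exact: d.
  by move=> _; apply: dj.
by move=> _; rewrite disjoint_sym; apply: dj.
Qed.

Lemma extends_disjoint R B b : extends R B b -> [disjoint b & cover B].
Proof.
case/and3P=> _ nB /matchingP[_ d]; rewrite /cover; apply/bigcup_disjoint => e eB.
by apply: d; rewrite ?setU11 ?setU1r //; apply: contraNneq nB => ->.
Qed.

Lemma extends_card R B b : extends R B b -> #|b| = 2.
Proof. by case/and3P=> _ _ /matchingP[c _]; apply: c; rewrite setU11. Qed.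

Lemma extendsI R B b : matching B ->
  #|b| = 2 -> [disjoint b & cover B] -> b \notin R -> extends R B b.
Proof.
move=> mB cb db bR; apply/and3P; split=> //; last exact: matching_add.
apply/negP=> bB; have /subset_leq_card : b \subset set0.
  rewrite -(disjoint_setI0 db) subsetI subxx.
  by apply: bigcup_sup.
by rewrite cb cards0.
Qed.

Lemma matching_meet S e1 e2 x :
  matching S -> e1 \in S -> e2 \in S -> x \in e1 -> x \in e2 -> e1 = e2.
Proof.
case/matchingP=> _ d h1 h2 x1 x2; apply/eqP; apply: contraLR isT => ne.
by have := disjointFr (d _ _ h1 h2 ne) x1; rewrite x2.
Qed.

(** Two pairs sharing exactly one vertex cannot both lie in a matching. *)
Lemma pair_outside_matching S F : matching S -> 2 < #|F| ->
  exists e, [/\ e \subset F, #|e| = 2 & e \notin S].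
Proof.
move=> mS /card_gt2P[x [y [z [[xF yF zF] [xy yz zx]]]]].
have [h1|h1] := boolP ([set x; y] \in S); last first.
  by exists [set x; y]; rewrite subUset !sub1set xF yF cards2 xy.
exists [set x; z]; rewrite subUset !sub1set xF zF cards2 eq_sym zx.
split=> //; apply/negP=> h2.
have /setP/(_ y) : [set x; y] = [set x; z].
  by apply: (matching_meet mS h1 h2 (x := x)); rewrite !inE eqxx.
by rewrite !inE eqxx orbT (negPf yz) eq_sym (negPf xy).
Qed.

(* The three perfect matchings of K_4 are disjoint, and two edges of S inside
   F belong to the same one. *)
Lemma perfect_matching_outside_matching S F : matching S -> #|F| = 4 ->
  exists e1 e2, [/\ e1 \subset F, e2 \subset F, [disjoint e1 & e2],
    #|e1| = 2 /\ #|e2| = 2 & e1 \notin S /\ e2 \notin S].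
Proof.
move=> mS; rewrite cardE => sF.
have sub e : {subset e <= enum F} -> e \subset F.
  by move=> h; apply/subsetP=> u /h; rewrite mem_enum.
case: (enum F) (enum_uniq F) sF sub => [|x [|y [|z [|t []]]]] //= uF _ sub.
have {uF} [xy xz xt yz [yt zt]] :
    [/\ x != y, x != z, x != t, y != z & y != t /\ z != t].
  by move: uF; rewrite !inE !negb_or !andbT => /and3P[/and3P[-> -> ->] /andP[-> ->] ->].
have subF u v : u \in [:: x; y; z; t] -> v \in [:: x; y; z; t] ->
    [set u; v] \subset F.
  by move=> hu hv; apply: sub => w /set2P[]->.
have dis (u v u' v' : T) : u != u' -> u != v' -> v != u' -> v != v' ->
    [disjoint [set u; v] & [set u'; v']].
  move=> h1 h2 h3 h4; rewrite -setI_eq0; apply/eqP/setP=> w; rewrite !inE.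
  by apply/negP=> /andP[/orP[]/eqP-> /orP[]]; apply/negP.
have meet (p q : {set T}) w v : p \in S -> w \in p -> v \in p -> w \in q -> v \notin q ->
    q \notin S.
  move=> pS wp vp wq; apply: contra => qS.
  by rewrite (matching_meet mS qS pS wq wp).
have [/andP[h1 h2]|] := boolP (([set x; y] \notin S) && ([set z; t] \notin S)).
  exists [set x; y], [set z; t]; split; rewrite ?cards2 ?xy ?zt //.
  - by apply: subF; rewrite !inE eqxx ?orbT.
  - by apply: subF; rewrite !inE eqxx ?orbT.
  - by apply: dis.
rewrite negb_and !negbK => h.
exists [set x; z], [set y; t]; split; rewrite ?cards2 ?xz ?yt //.
- by apply: subF; rewrite !inE eqxx ?orbT.
- by apply: subF; rewrite !inE eqxx ?orbT.
- by apply: dis; rewrite // eq_sym.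
case/orP: h => h; split.
- by apply: (meet _ _ x y h); rewrite !inE ?eqxx ?orbT // eq_sym (negPf xy).
- by apply: (meet _ _ y x h); rewrite !inE ?eqxx ?orbT // (negPf xy).
- apply: (meet _ _ z t h); rewrite !inE ?eqxx ?orbT //.
  by rewrite ![t == _]eq_sym (negPf xt).
- by apply: (meet _ _ t z h); rewrite !inE ?eqxx ?orbT // eq_sym (negPf yz).
Qed.

Lemma card_uncovered S : matching S -> #|~: cover S| = #|T| - #|S| * 2.
Proof.
by move=> mS; rewrite -(card_cover_matching mS) -(cardsC (cover S)) addKn.
Qed.

Lemma matching_leq S : matching S -> #|S| * 2 <= #|T|.
Proof. by move=> mS; rewrite -card_cover_matching // max_card. Qed.

(** At least three vertices are missed by blue, and red, still a matching after A's move, cannot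
    contain all pairs among them. *)
Lemma safe_of_card R B : matching B -> #|B| * 2 + 2 < #|T| -> safe R B.
Proof.
move=> mB lt; apply/forallP=> r; apply/implyP=> /and3P[_ _ mR].
have : 2 < #|~: cover B| by rewrite card_uncovered // ltn_subRL.
case/(pair_outside_matching mR)=> b [bF cb bR]; apply/existsP; exists b.
by apply: extendsI => //; rewrite disjoints_subset.
Qed.

Lemma safe_reply R B b0 : matching R -> matching B -> #|R| = #|B|.+1 ->
  extends R B b0 -> exists b, extends R B b && safe R (b |: B).
Proof.
move=> mR mB cR x0.
have cB b : extends R B b -> #|b |: B| = #|B|.+1.
  by case/and3P=> _ nB _; rewrite cardsU1 nB.
have mB0 : matching (b0 |: B) by case/and3P: x0.
(* Blue misses more than 4 vertices: any extension leaves more than 2 of them. *)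
have [lt|le4] := ltnP (#|B|.+1 * 2 + 2) #|T|.
  by exists b0; rewrite x0 safe_of_card // cB.
(* Fewer than 4 are missed: a further red edge would give a matching with [#|B| + 2] edges, too many
   for [T], so safety is vacuous. *)
have [lt4|ge4] := ltnP #|T| (#|B| * 2 + 4).
  exists b0; rewrite x0; apply/forallP=> r; apply/implyP=> /and3P[rB rR mrR].
  by have := matching_leq mrR; rewrite cardsU1 rR cR; lia.
have cT : #|T| = #|B| * 2 + 4 by lia.
have cF : #|~: cover B| = 4 by rewrite card_uncovered // cT addKn.
have cC : #|~: cover R| = 2.
  by rewrite card_uncovered // cT cR; lia.
(* Adding the pair missed by red keeps [e1] and [e2] clear of A's next move as well. *)
have mC : matching (~: cover R |: R).
  by apply: matching_add; rewrite // disjoints_subset.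
have [e1 [e2 [s1 s2 d12 [c1 c2] [n1 n2]]]] :=
  perfect_matching_outside_matching mC cF.
have x1 : extends R B e1.
  apply: extendsI => //; rewrite ?disjoints_subset //.
  by apply: contra n1 => ?; rewrite setU1r.
exists e1; rewrite x1; apply/forallP=> r; apply/implyP=> xr.
have -> : r = ~: cover R.
  apply/eqP; rewrite eqEcard cC (extends_card xr) andbT -disjoints_subset.
  exact: extends_disjoint xr.
apply/existsP; exists e2; apply: extendsI => //; first by case/and3P: x1.
rewrite disjoint_sym /cover bigcup_setU big_set1 -/(cover B) disjoints_subset.
by rewrite subUset -disjoints_subset d12 -disjoints_subset disjoint_sym disjoints_subset.
Qed.

(** Injectivity comes for free: [f] maps [cover S] onto [cover S'], which has the same size. So the
    induction, which matches up one edge at a time, only has to produce [f]. *)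
Lemma matching_map S S' : matching S -> matching S' -> #|S| = #|S'| ->
  exists2 f : T -> T, {in cover S &, injective f} &
    [set f @: e | e : {set T} in S] = S'.
Proof.
move=> mS mS' cS.
suff [f fS] : exists f : T -> T, [set f @: e | e : {set T} in S] = S'.
  exists f => //; apply/imset_injP.
  rewrite imset_cover -cover_imset fS.
  by rewrite !card_cover_matching ?cS.
have [m] := ubnP #|S|; elim: m S S' mS mS' cS => // m IH S S' mS mS' cS lt.
have [S0|[e eS]] := set_0Vmem S.
  by exists id; rewrite S0 imset0; apply/esym/eqP; rewrite -cards_eq0 -cS S0 cards0.
have [S'0|[e' eS']] := set_0Vmem S'.
  by move: cS; rewrite S'0 (cardsD1 e) eS cards0.
have [f fS] : exists f : T -> T, [set f @: e | e : {set T} in S :\ e] = S' :\ e'.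
  apply: IH; rewrite ?(matching_sub (subsetDl _ _)) //.
    by move: cS; rewrite (cardsD1 e) eS (cardsD1 e' S') eS' => -[].
  by move: lt; rewrite (cardsD1 e) eS.
have /matchingP[cS2 dS] := mS; have /matchingP[cS2' _] := mS'.
have /eqP/cards2P[a [b [ab ee]]] := cS2 _ eS.
have /eqP/cards2P[a' [b' [_ ee']]] := cS2' _ eS'.
(* Redefining [f] on [e] does not disturb the other edges, which are disjoint from [e]. *)
pose g x := if x == a then a' else if x == b then b' else f x.
exists g; rewrite -(setD1K eS) imsetU1 -(setD1K eS') -fS; congr (_ |: _).
  rewrite ee ee' imsetU1 imset_set1 /g !eqxx.
  by rewrite eq_sym (negPf ab).
apply: eq_in_imset => u /setD1P[ue uS]; apply: eq_in_imset => x xu.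
have := disjointFr (dS _ _ uS eS ue) xu.
by rewrite ee !inE /g => /norP[/negPf-> /negPf->].
Qed.

End Matchings.

(** * Isomorphisms between subgraphs *)

(** The isomorphism is [f] followed by the inverse of [j]. Comparing both graphs inside [V] allows a
    total [f], with [j] the inclusion of a vertex subset or the identity. *)
Lemma subgraph_iso (G K : sgraph) (V : finType) (W : {set G})
    (S : {set {set G}}) (f : G -> V) (j : K -> V) :
    S \subset edges G -> (forall e, e \in S -> e \subset W) ->
    {in W &, injective f} -> injective j -> f @: W = j @: setT ->
    (forall e : {set K}, (e \in edges K) = (j @: e \in [set f @: u | u : {set G} in S])) ->
  graph_iso (subgraph W S) K.
Proof.
move=> SE SW fI jI fW eK.
have cod (x : {x | x \in W}) : f (val x) \in codom j.
  have : f (val x) \in j @: setT by rewrite -fW imset_f ?(valP x).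
  by case/imsetP=> k _ ->; apply: codom_f.
pose g (x : subgraph W S) : K := iinv (cod x).
have jg x : j (g x) = f (val x) by apply: f_iinv.
have gI : injective g.
  move=> x y xy; apply/val_inj/fI; try exact: valP.
  by rewrite -!jg xy.
exists g.
  apply: inj_card_bij => //; rewrite card_sig -(card_in_imset fI) fW.
  by rewrite card_imset // cardsT.
move=> e; rewrite eK inE.
have -> : j @: (g @: e) = f @: (val @: e).
  by rewrite -!imset_comp; apply: eq_imset.
have eW : val @: e \subset W by apply/subsetP=> _ /imsetP[x _ ->]; apply: valP.
rewrite inE; apply/imsetP/andP=> [[u uS fe]|[eS _]]; last by exists (val @: e).
suff -> : val @: e = u by split=> //; apply: (subsetP SE).
have lift (p q : {set G}) : p \subset W -> q \subset W -> f @: p = f @: q -> p \subset q.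
  move=> /subsetP pW /subsetP qW pq; apply/subsetP=> x xp.
  have /imsetP[y yq xy] : f x \in f @: q by rewrite -pq imset_f.
  by rewrite (fI _ _ (pW _ xp) (qW _ yq) xy).
have uW := SW u uS.
by apply/eqP; rewrite eqEsubset; apply/andP; split; apply: lift.
Qed.

Lemma formed_by_iso (G : sgraph) (S S' : {set {set G}}) :
  S \subset edges G -> S' \subset edges G -> matching S -> matching S' ->
  #|S| = #|S'| -> graph_iso (formed_by S) (formed_by S').
Proof.
move=> SE SE' mS mS' cS; have [f fI fS] := matching_map mS mS' cS.
apply: (subgraph_iso (f := f) (j := (val : formed_by S' -> G))) => //.
- by move=> e eS; apply: bigcup_sup.
- exact: val_inj.
- rewrite imset_cover -cover_imset fS.
  apply/setP=> x; apply/idP/imsetP=> [xS|[y _ ->]]; last exact: valP.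
  by exists (exist _ x xS).
- move=> e; rewrite fS inE in_setI; apply: andb_idr; exact: (subsetP SE').
Qed.

Lemma edges_P2 : edges (path_graph 2) =
  [set [set inord 0; inord 1]; [set inord 1; inord 2]] :> {set {set 'I_3}}.
Proof.
apply/setP=> u; rewrite !inE; apply/imsetP/idP=> [[i _ ->]|].
  by case: i => -[|[|]] // i2 /=; rewrite eqxx ?orbT.
by case/orP=> /eqP->; [exists ord0 | exists ord_max].
Qed.

(** Two distinct edges meeting in [x] form a copy of P_2 with [x] in the middle. *)
Lemma no_P2_matching (G : sgraph) (S : {set {set G}}) :
  S \subset edges G -> ~ contains_copy S (path_graph 2) -> matching S.
Proof.
move=> SE nP; have cS e : e \in S -> #|e| = 2 by move/(subsetP SE)/edges_card2.
apply/matchingP; split=> // e1 e2 h1 h2 ne.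
apply: contraT => /pred0Pn[x /andP[/= x1 x2]]; case: nP.
have other e : e \in S -> x \in e -> exists2 y, y != x & e = [set x; y].
  move=> eS; have /eqP/cards2P[a [b [ab ->]]] := cS _ eS.
  case/set2P=> ->; first by exists b; rewrite // eq_sym.
  by exists a; rewrite // setUC.
have [y yx ey] := other _ h1 x1; have [z zx ez] := other _ h2 x2.
have yz : y != z by apply: contraNneq ne => yz; rewrite ey ez yz.
(* The last branch is meant for [z]; values outside [e1 :|: e2] do not matter. *)
pose f v : 'I_3 := if v == x then inord 1 else if v == y then inord 0 else inord 2.
have fx : f x = inord 1 by rewrite /f eqxx.
have fy : f y = inord 0 by rewrite /f (negPf yx) eqxx.
have fz : f z = inord 2 by rewrite /f (negPf zx) eq_sym (negPf yz).
have o3 (k l : nat) : k < 3 -> l < 3 -> (inord k == inord l :> 'I_3) = (k == l).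
  by move=> k3 l3; rewrite -val_eqE /= !inordK.
exists (e1 :|: e2), [set e1; e2]; first by rewrite subUset !sub1set h1.
apply: (subgraph_iso (f := f) (j := (id : path_graph 2 -> 'I_3))).
- by rewrite subUset !sub1set !(subsetP SE).
- by move=> e /set2P[]->; rewrite ?subsetUl ?subsetUr.
- rewrite ey ez => u v; rewrite !inE.
  move=> /orP[]/orP[]/eqP-> /orP[]/orP[]/eqP-> //;
  by rewrite ?fx ?fy ?fz => /eqP; rewrite o3.
- exact: inj_id.
- rewrite imset_id imsetU ey ez !imsetU !imset_set1 fx fy fz.
  apply/setP=> k; rewrite !inE; case: k => -[|[|[|]]] // k3.
  + by rewrite -!val_eqE /= !inordK.
  + by rewrite -!val_eqE /= !inordK.
  + by rewrite -!val_eqE /= !inordK.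
- move=> e; rewrite imset_id.
  suff -> : [set f @: u | u : {set G} in [set e1; e2]] = edges (path_graph 2) by [].
  rewrite edges_P2 imsetU !imset_set1 ey ez !imsetU !imset_set1 fx fy fz.
  by rewrite [X in X |: _]setUC.
Qed.

(** * Histories, and strategies obtained from replies to whole histories *)

Section Histories.
Variables G F : sgraph.
Implicit Types (h : history G) (e : {set G}) (p : player).

Lemma moves_of_rcons p h e :
  moves_of p (rcons h e) =
  if turn h == p then rcons (moves_of p h) e else moves_of p h.
Proof.
rewrite /moves_of size_rcons mkseqS -!cats1 mask_cat ?size_mkseq //= /turn.
by case: ifP => _; rewrite ?cats0.
Qed.

Lemma red_edges_rcons h e :
  red_edges (rcons h e) = if turn h then red_edges h else e |: red_edges h.
Proof.
rewrite /red_edges moves_of_rcons; case: (turn h) => //=.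
by apply/setP=> u; rewrite !inE mem_rcons inE.
Qed.

Lemma blue_edges_rcons h e :
  blue_edges (rcons h e) = if turn h then e |: blue_edges h else blue_edges h.
Proof.
rewrite /blue_edges moves_of_rcons; case: (turn h) => //=.
by apply/setP=> u; rewrite !inE mem_rcons inE.
Qed.

Lemma mem_history h e : (e \in h) = (e \in red_edges h) || (e \in blue_edges h).
Proof.
elim/last_ind: h => [|h a IH]; first by rewrite !inE.
rewrite mem_rcons in_cons red_edges_rcons blue_edges_rcons IH.
by case: (turn h); rewrite in_setU1; [apply: orbCA | apply: orbA].
Qed.

Lemma turn_rcons h e : turn (rcons h e) = ~~ turn h.
Proof. by rewrite /turn size_rcons. Qed.

Lemma follows_rcons p s h e : follows p s (rcons h e) ->
  follows p s h /\ (turn h = p -> e = s (moves_of (~~ p) h)).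
Proof.
move=> fl; split=> [i ih ip|hp].
  have := fl i; rewrite size_rcons nth_rcons ih -cats1 takel_cat 1?ltnW //.
  by apply; rewrite ?ltnS 1?ltnW.
have := fl (size h); rewrite size_rcons nth_rcons ltnn eqxx -cats1 take_size_cat //.
by apply.
Qed.

Lemma colored_edges h : legal F h ->
  red_edges h \subset edges G /\ blue_edges h \subset edges G.
Proof.
elim=> [|h' e _ [sR sB] _ /andP[eE _]].
  by split; apply/subsetP=> e; rewrite inE.
rewrite red_edges_rcons blue_edges_rcons.
by case: (turn h'); split; rewrite // subUset sub1set eE.
Qed.

Variable reply : history G -> {set G}.

(** A strategy sees only the opponent's moves, while [reply] looks at the whole history; B's own
    moves are therefore recomputed from A's. *)
Definition replay (s : seq {set G}) : history G :=
  foldl (fun h a => let h' := rcons h a in rcons h' (reply h')) [::] s.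

Definition strategy_of_reply (s : seq {set G}) : {set G} :=
  last set0 (replay s).

Lemma replay_rcons s a : let h := rcons (replay s) a in
  replay (rcons s a) = rcons h (reply h).
Proof. by rewrite /replay -cats1 foldl_cat. Qed.

(** On B's turn [replay] is one move ahead of [h], because it answers each move of A at once; its
    last entry is the move B is about to make. *)
Lemma replay_follows h : legal F h -> follows playerB strategy_of_reply h ->
  if turn h then replay (moves_of playerA h) = rcons h (reply h)
  else replay (moves_of playerA h) = h.
Proof.
elim=> // {}h e _ IH _ _ /follows_rcons[/IH {}IH eB].
rewrite turn_rcons moves_of_rcons; case: (boolP (turn h)) IH eB => /= _ IH eB.
  by rewrite IH eB // /strategy_of_reply IH last_rcons.
by rewrite replay_rcons IH.
Qed.

Lemma strategy_of_replyE h :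
  legal F h -> follows playerB strategy_of_reply h -> turn h ->
  strategy_of_reply (moves_of playerA h) = reply h.
Proof.
move=> lh fh th; have := replay_follows lh fh.
by rewrite th /strategy_of_reply => ->; rewrite last_rcons.
Qed.

End Histories.

(** * The game on the complete graph *)

Section CompleteGraph.
Variable n : nat.
Hypothesis n_ge3 : 3 <= n.
Local Notation G := (complete_graph n).
Local Notation P2 := (path_graph 2).

Definition safe_reply_move (h : history G) : {set G} :=
  odflt set0 [pick b | extends (red_edges h) (blue_edges h) b &&
                       safe (red_edges h) (b |: blue_edges h)].

Local Notation sB := (strategy_of_reply safe_reply_move).

(** The invariant after each move of B: the first three clauses yield the isomorphism, [safe] the
    existence of the next reply. *)
Definition balanced (h : history G) :=
  [/\ matching (red_edges h), matching (blue_edges h),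
      #|red_edges h| = #|blue_edges h| & safe (red_edges h) (blue_edges h)].

Lemma balanced_nil : balanced [::].
Proof.
have e0 p : [set e in moves_of p [::]] = set0 :> {set {set G}}.
  by apply/setP=> e; rewrite !inE.
rewrite /balanced /red_edges /blue_edges !e0; split=> //; try exact: matching0.
(* With no edge colored, the bound required is [2 < n], which is [n_ge3]. *)
by apply: safe_of_card; rewrite ?cards0 ?card_ord //; exact: matching0.
Qed.

Lemma safe_reply_moveP (h : history G) a : let h' := rcons h a in
  legal P2 h' -> turn h = playerA -> uncolored h a -> balanced h ->
  ~ ended P2 h' ->
  uncolored h' (safe_reply_move h') /\ balanced (rcons h' (safe_reply_move h')).
Proof.
move=> h' lh' th ua [mR mB cRB sf] ne.
have [sR' _] := colored_edges lh'.
have R'E : red_edges h' = a |: red_edges h by rewrite red_edges_rcons th.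
have B'E : blue_edges h' = blue_edges h by rewrite blue_edges_rcons th.
have mR' : matching (red_edges h').
  by apply: no_P2_matching => // cR; apply: ne; constructor 1.
case/andP: ua => _; rewrite mem_history negb_or => /andP[aR aB].
have cR' : #|red_edges h'| = #|blue_edges h'|.+1.
  by rewrite R'E B'E cardsU1 aR cRB.
(* Safety before A's move gives some answer [b0]; [safe_reply] turns it into one that is safe
   again. *)
have /existsP[b0 xb0] : [exists b, extends (red_edges h') (blue_edges h') b].
  move/forallP/(_ a)/implyP: sf; rewrite R'E B'E; apply.
  by rewrite /extends aB aR -R'E.
rewrite -B'E in mB; have [b xb] := safe_reply mR' mB cR' xb0.
have {b xb} /andP[x s] :
    extends (red_edges h') (blue_edges h') (safe_reply_move h') &&
    safe (red_edges h') (safe_reply_move h' |: blue_edges h').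
  by rewrite /safe_reply_move; case: pickP => [//|/(_ b)]; rewrite xb.
have cb := extends_card x; case/and3P: (x) => nR nB mB'; split.
  by rewrite /uncolored mem_history negb_or nR nB inE cb.
rewrite /balanced red_edges_rcons blue_edges_rcons turn_rcons th /=.
by split; rewrite // cardsU1 nB cR'.
Qed.

(** On B's turn the invariant is stated one move back: a legal history may end with a move of A that
    creates a red P_2. *)
Lemma balanced_follows (h : history G) : legal P2 h -> follows playerB sB h ->
  if turn h then exists h0 a,
    [/\ h = rcons h0 a, turn h0 = playerA, uncolored h0 a & balanced h0]
  else balanced h.
Proof.
elim=> [_|{}h e lh IH ne ue]; first exact: balanced_nil.
move/follows_rcons=> [fh eB]; have := IH fh.
rewrite turn_rcons; case: (boolP (turn h)) => th /=; last first.
  by exists h, e; split=> //; apply: negbTE.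
case=> h0 [a [hE th0 ua bal]].
rewrite eB // (strategy_of_replyE lh fh th); rewrite hE in lh ne *.
by have [] := safe_reply_moveP lh th0 ua bal ne.
Qed.

Lemma strategy_of_safe_reply : symmetric_strategy P2 sB.
Proof.
split=> [h lh fh th ne|sA _ h lh _ fh _ th].
  rewrite (strategy_of_replyE lh fh th); have := balanced_follows lh fh.
  rewrite th => -[h0 [a [hE th0 ua bal]]]; rewrite hE in lh ne *.
  by have [] := safe_reply_moveP lh th0 ua bal ne.
have := balanced_follows lh fh; rewrite th => -[mR mB c _].
by have [sR sB'] := colored_edges lh; apply: formed_by_iso.
Qed.

End CompleteGraph.

Theorem theorem6 (n : nat) (hn : 3 <= n) :
  exists sB : seq {set complete_graph n} -> {set complete_graph n},
    symmetric_strategy (path_graph 2) sB.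
Proof.
by exists (strategy_of_reply (@safe_reply_move n)); apply: strategy_of_safe_reply.
Qed.
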